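(* Let $K$ be a field of characteristic zero, $m\ge 1$, and $\widehat{P}_m=K[[x_1,\dots,x_m]]$. Let $\sigma$ be a continuous $K$-algebra automorphism of $\widehat{P}_m$ and $a\in\widehat{P}_m$. Then $$\sigma^{-1}(a)=\sum_{\alpha\in\mathbb{N}^m}\phi_\sigma\!\left(\frac{(\partial')^\alpha}{\alpha!}\,a\right)x^\alpha,$$ where $(\partial')^\alpha=(\partial_1')^{\alpha_1}\cdots(\partial_m')^{\alpha_m}$, $\alpha!=\alpha_1!\cdots\alpha_m!$, $x^\alpha=x_1^{\alpha_1}\cdots x_m^{\alpha_m}$, and $\partial_i'$ and $\phi_\sigma$ are the derivations and the map attached to $\sigma$ as defined in the context.
   Context: $\widehat{P}_m$ carries the $\mathfrak m$-adic topology, $\mathfrak m=(x_1,\dots,x_m)$. For a continuous $K$-algebra automorphism $\sigma$ of $\widehat P_m$ put $x_i':=\sigma(x_i)$ (these lie in the maximal ideal) and $\Delta:=\det\left(\frac{\partial x_i'}{\partial x_j}\right)_{1\le i,j\le m}$, which is a unit of $\widehat P_m$. For $i=1,\dots,m$, $\partial_i'=\partial/\partial x_i'$ is the continuous $K$-derivation of $\widehat P_m$ given by: $\partial_i'(f)=\Delta^{-1}$ times the determinant of the matrix obtained from $\left(\frac{\partial \sigma(x_k)}{\partial x_l}\right)_{k,l}$ by replacing its $i$-th row by $\left(\frac{\partial f}{\partial x_1},\dots,\frac{\partial f}{\partial x_m}\right)$. These derivations commute and satisfy $\partial_i'(x_j')=\delta_{ij}$. Define $$\phi_i':=\sum_{k\ge0}(-1)^k\frac{(x_i')^k}{k!}(\partial_i')^k:\widehat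 P_m\to\widehat P_m$$ (the sum converges $\mathfrak m$-adically) and $\phi_\sigma:=\phi_1'\cdots\phi_m'$ (composition). *)

(* Defs.v *)
From HB Require Import structures.
From mathcomp Require Import all_boot all_order all_algebra.
From mathcomp Require Import finmap.
From mathcomp Require Import mathcomp_extra boolp classical_sets filter topology.
From mathcomp Require Import mpoly.

Set Implicit Arguments.
Unset Strict Implicit.
Unset Printing Implicit Defensive.
Import GRing.Theory.

Local Open Scope classical_set_scope.
Local Open Scope ring_scope.

(* R[[x_1, ..., x_m]]: a power series is the family of its coefficients,
   indexed by the multi-exponents 'X_{1..m} of the multinomials library. *)
Record mfps (m : nat) (R : comNzRingType) : Type :=
  Mfps { mfps_coef :> 'X_{1..m} -> R }.

Section MfpsRing.
Context (m : nat) (R : comNzRingType).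
Local Notation P := (mfps m R).
Implicit Types f g h : P.

HB.instance Definition _ := [isNew for @mfps_coef m R].
HB.instance Definition _ := [Choice of P by <:].

Lemma mfpsP f g : (forall a, f a = g a) -> f = g.
Proof. by case: f g => f [g] /= fg; congr Mfps; apply/funext. Qed.

Definition mfps_zero : P := Mfps (fun=> 0).
Definition mfps_opp f : P := Mfps (fun a => - f a).
Definition mfps_add f g : P := Mfps (fun a => f a + g a).

Fact mfps_addA : associative mfps_add.
Proof. by move=> f g h; apply: mfpsP => a /=; rewrite addrA. Qed.
Fact mfps_addC : commutative mfps_add.
Proof. by move=> f g; apply: mfpsP => a /=; rewrite addrC. Qed.
Fact mfps_add0 : left_id mfps_zero mfps_add.
Proof. by move=> f; apply: mfpsP => a /=; rewrite add0r. Qed.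
Fact mfps_addN : left_inverse mfps_zero mfps_opp mfps_add.
Proof. by move=> f; apply: mfpsP => a /=; rewrite addNr. Qed.

HB.instance Definition _ :=
  GRing.isZmodule.Build P mfps_addA mfps_addC mfps_add0 mfps_addN.

Definition mfps_one : P := Mfps (fun a => (a == 0%MM)%:R).

(* Cauchy product; the degree bound only serves to make the index type finite,
   as in mcoeffM. *)
Definition mfps_mul f g : P :=
  Mfps (fun a =>
    \sum_(k : 'X_{1..m < (mdeg a).+1, (mdeg a).+1} | a == (k.1 + k.2)%MM)
       f k.1 * g k.2).

Let trunc (d : nat) f : {mpoly R[m]} := \sum_(k : 'X_{1..m < d}) f k *: 'X_[k].

Let coef_trunc d f a : (mdeg a < d)%N -> (trunc d f)@_a = f a.
Proof. exact: mcoeff_mpoly. Qed.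

Let coef_mul d f g a : (mdeg a < d)%N ->
  mfps_mul f g a = (trunc d f * trunc d g)@_a.
Proof.
move=> ad; rewrite mcoeffM; apply: eq_bigr => -[[k1 /= k1a] [k2 /= k2a]] _ /=.
by rewrite !coef_trunc // (leq_trans _ ad).
Qed.

Fact mfps_mulA : associative mfps_mul.
Proof.
move=> f g h; apply: mfpsP => a; have lea := ltnSn (mdeg a).
transitivity (trunc (mdeg a).+1 f * (trunc (mdeg a).+1 g * trunc (mdeg a).+1 h))@_a.
  rewrite mcoeffM; apply: eq_bigr => -[[k1 /= k1a] [k2 /= k2a]] _.
  by rewrite -coef_mul // coef_trunc.
rewrite mulrA mcoeffM; apply: eq_bigr => -[[k1 /= k1a] [k2 /= k2a]] _.
by rewrite -coef_mul // coef_trunc.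
Qed.

Fact mfps_mulC : commutative mfps_mul.
Proof.
by move=> f g; apply: mfpsP => a; rewrite !(coef_mul _ _ (ltnSn _)) mulrC.
Qed.

Fact mfps_mul1 : left_id mfps_one mfps_mul.
Proof.
move=> f; apply: mfpsP => a.
transitivity ((1 * trunc (mdeg a).+1 f)@_a); last by rewrite mul1r coef_trunc.
rewrite mcoeffM; apply: eq_bigr => -[[k1 /= k1a] [k2 /= k2a]] _.
by rewrite mcoeff1 coef_trunc.
Qed.

Fact mfps_mulDl : left_distributive mfps_mul mfps_add.
Proof.
move=> f g h; apply: mfpsP => a /=; rewrite -big_split /=.
by apply: eq_bigr => k _; rewrite mulrDl.
Qed.

Fact mfps_one_neq0 : mfps_one != 0.
Proof.
apply/eqP => /(congr1 (fun f : P => f 0%MM)) /= /eqP.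
by rewrite eqxx oner_eq0.
Qed.

HB.instance Definition _ := GRing.Zmodule_isComNzRing.Build P
  mfps_mulA mfps_mulC mfps_mul1 mfps_mulDl mfps_one_neq0.

Definition mfps_scale (c : R) f : P := Mfps (fun a => c * f a).

Fact mfps_scaleA c d f : mfps_scale c (mfps_scale d f) = mfps_scale (c * d) f.
Proof. by apply: mfpsP => a /=; rewrite mulrA. Qed.
Fact mfps_scale1 : left_id 1 mfps_scale.
Proof. by move=> f; apply: mfpsP => a /=; rewrite mul1r. Qed.
Fact mfps_scaleDr : right_distributive mfps_scale +%R.
Proof. by move=> c f g; apply: mfpsP => a /=; rewrite mulrDr. Qed.
Fact mfps_scaleDl f : {morph mfps_scale^~ f : c d / c + d}.
Proof. by move=> c d; apply: mfpsP => a /=; rewrite mulrDl. Qed.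

HB.instance Definition _ := GRing.Zmodule_isLmodule.Build R P
  mfps_scaleA mfps_scale1 mfps_scaleDr mfps_scaleDl.

Fact mfps_scaleAl (c : R) f g : c *: (f * g) = (c *: f) * g.
Proof.
apply: mfpsP => a /=; rewrite big_distrr /=.
by apply: eq_bigr => k _; rewrite mulrA.
Qed.

HB.instance Definition _ := GRing.Lmodule_isLalgebra.Build R P mfps_scaleAl.
HB.instance Definition _ := GRing.Lalgebra_isComAlgebra.Build R P.

Definition mfps_unit : {pred P} := fun f => `[< exists g : P, g * f = 1 >].
Definition mfps_inv f : P :=
  if pselect (exists g : P, g * f = 1) is left ex then projT1 (cid ex) else f.

Fact mfps_mulV : {in mfps_unit, left_inverse 1 mfps_inv *%R}.
Proof.
move=> f /asboolP fU; rewrite /mfps_inv; case: pselect => // ex.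
by case: (cid ex).
Qed.
Fact mfps_unitP f g : g * f = 1 -> mfps_unit f.
Proof. by move=> gf; apply/asboolP; exists g. Qed.
Fact mfps_inv_out : {in [predC mfps_unit], mfps_inv =1 id}.
Proof.
move=> f; rewrite inE => /asboolPn fU; rewrite /mfps_inv.
by case: pselect.
Qed.

HB.instance Definition _ := GRing.ComNzRing_hasMulInverse.Build P
  mfps_mulV mfps_unitP mfps_inv_out.

End MfpsRing.

Section IdealPower.
Context (A : comNzRingType).
Implicit Types I J : set A.

Definition ideal_prod I J : set A :=
  [set x | exists2 s : seq (A * A), (forall p, p \in s -> I p.1 /\ J p.2) &
             x = \sum_(p <- s) p.1 * p.2].

Fixpoint ideal_exp I (n : nat) : set A :=
  if n is n'.+1 then ideal_prod I (ideal_exp I n') else setT.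

Lemma ideal_exp0 I n : ideal_exp I n 0.
Proof. by case: n => //= n; exists [::] => //; rewrite big_nil. Qed.

Lemma ideal_expD I n x y :
  ideal_exp I n x -> ideal_exp I n y -> ideal_exp I n (x + y).
Proof.
case: n => //= n [s Is ->] [t It ->]; exists (s ++ t); last by rewrite big_cat.
by move=> p; rewrite mem_cat => /orP[/Is|/It].
Qed.

Lemma ideal_expM I n r x : ideal_exp I n x -> ideal_exp I n (r * x).
Proof.
elim: n x => //= n IHn _ [s Is ->].
exists [seq (p.1, r * p.2) | p <- s].
  by move=> _ /mapP[p /Is [Ip Jp] ->]; split=> //; apply: IHn.
by rewrite big_map big_distrr; apply: eq_bigr => p _; rewrite /= mulrCA.
Qed.

Lemma ideal_exp_le I n k : (n <= k)%N -> ideal_exp I k `<=` ideal_exp I n.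
Proof.
move=> /subnK <-; elim: (k - n)%N => [//|d IHd] x; rewrite addSn.
move=> [s Is ->]; apply: IHd; elim: s Is => [|p s IHs] Is.
  by rewrite big_nil; apply: ideal_exp0.
rewrite big_cons; apply: ideal_expD.
  by apply: ideal_expM; case: (Is p); rewrite ?mem_head.
by apply: IHs => q qs; apply: Is; rewrite in_cons qs orbT.
Qed.

End IdealPower.

Section AdicTopology.
Context (m : nat) (R : comNzRingType).
Local Notation P := (mfps m R).

Definition mfps_var (i : 'I_m) : P := Mfps (fun a => (a == U_(i)%MM)%:R).

Definition mfps_monomial (a : 'X_{1..m}) : P :=
  \prod_(i < m) mfps_var i ^+ a i.

Definition mfps_maxideal : set P :=
  [set f | exists g : 'I_m -> P, f = \sum_(i < m) g i * mfps_var i].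

Definition adic_nbhs (f : P) : set_system P :=
  filter_from setT
    (fun n => [set g : P | ideal_exp mfps_maxideal n (g - f)]).

HB.instance Definition _ := hasNbhs.Build P adic_nbhs.
HB.instance Definition _ := isPointed.Build P 0.

Fact adic_nbhs_filter (f : P) : ProperFilter (nbhs f).
Proof.
apply: filter_from_proper.
  apply: filter_fromT_filter; first by exists 0%N.
  move=> i j; exists (maxn i j) => g /= gf.
  by split; apply: ideal_exp_le gf; rewrite (leq_maxl, leq_maxr).
by move=> n _; exists f; rewrite /= subrr; apply: ideal_exp0.
Qed.

Fact adic_nbhs_singleton (f : P) (A : set P) : nbhs f A -> A f.
Proof. by move=> [n _]; apply; rewrite /= subrr; apply: ideal_exp0. Qed.

Fact adic_nbhs_nbhs (f : P) (A : set P) : nbhs f A -> nbhs f (nbhs^~ A).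
Proof.
move=> [n _ nA]; exists n => // g /= gf; exists n => // h /= hg.
by apply: nA; rewrite /= -(subrKA g); apply: ideal_expD.
Qed.

HB.instance Definition _ := Nbhs_isNbhsTopological.Build P
  adic_nbhs_filter adic_nbhs_singleton adic_nbhs_nbhs.

End AdicTopology.

(* The filter of "large enough" finite subsets of I, along which unordered sums
   over I converge. *)
Definition totally (I : choiceType) : set_system {fset I} :=
  filter_from setT (fun A => [set B | (A `<=` B)%fset]).
Arguments totally {I}.

Section AttachedToAutomorphism.
Context (m : nat) (K : fieldType).
Local Notation P := (mfps m K).

Definition mfps_deriv (i : 'I_m) (f : P) : P :=
  Mfps (fun a => f (a + U_(i))%MM *+ (a i).+1).

Context (sigma : P -> P).

Definition jacobian_mx : 'M[P]_m :=
  \matrix_(k, l) mfps_deriv l (sigma (mfps_var K k)).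

Definition deriv' (i : 'I_m) (f : P) : P :=
  (\det jacobian_mx)^-1 *
  \det (\matrix_(k, l)
          if k == i then mfps_deriv l f else jacobian_mx k l).

Definition deriv'_exp (a : 'X_{1..m}) : P -> P :=
  \big[comp/idfun]_(i < m) iter (a i) (deriv' i).

Definition phi' (i : 'I_m) (f : P) : P :=
  limn (fun n => \sum_(0 <= k < n)
    (-1) ^+ k * ((k`!%:R : K)^-1 *: sigma (mfps_var K i) ^+ k)
      * iter k (deriv' i) f).

Definition phi : P -> P := \big[comp/idfun]_(i < m) phi' i.

End AttachedToAutomorphism.

(* Main.v *)
From HB Require Import structures.
From mathcomp Require Import all_boot all_order all_algebra.
From mathcomp Require Import finmap.
From mathcomp Require Import mathcomp_extra boolp classical_sets filter topology.
From mathcomp Require Import mpoly.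
Require Import Defs.
Import GRing.Theory.
Local Open Scope classical_set_scope.
Local Open Scope ring_scope.

Set Implicit Arguments.
Unset Strict Implicit.
Unset Printing Implicit Defensive.

(** Everything is conjugated back by [sigma]. By the chain rule the derivation
    [deriv' sigma i] is [sigma \o d_i \o sigma^-1], where [d_i] is the partial
    derivative with respect to [x_i] ([deriv'_sigma]). As [sigma] is continuous
    it commutes with the limit that defines [phi' sigma i], so this map is
    [sigma \o phi_i \o sigma^-1] with
    [phi_i = \sum_k (-1)^k / k! * x_i ^ k * d_i ^ k].
    This is Taylor's formula for the translation of [x_i] by [- x_i]: [phi_i]
    substitutes [0] for [x_i] ([phi'_sigma], from the alternating sum of
    binomial coefficients). The composite [phi sigma] therefore sends [sigma g]
    to the constant term of [g], which [sigma] fixes.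

    With [b = sigma^-1 a], the summand of index [alpha] is thus the constant term
    of [d^alpha b / alpha!], that is the coefficient of [x^alpha] in [b], times
    [x^alpha]. The series to be summed is the expansion of [b] into monomials,
    which converges to [b] ([monomial_expansion]).

    The topology enters through one fact, [ideal_exp_order]: the [n]-th power of
    the maximal ideal consists of the series without terms of degree less than
    [n]. It makes neighbourhoods explicit, gives separatedness (so that limits are
    unique), and reduces the chain rule to an induction on the order: the two
    sides differ by a [sigma]-derivation that kills every variable, and such a
    map takes its values in all powers of the maximal ideal ([chain_rule]). *)

(** * Coefficients and orders of power series *)

Section Order.
Context (m : nat) (R : comNzRingType).
Local Notation P := (mfps m R).
Implicit Types (f g : P) (p q : {mpoly R[m]}) (a b : 'X_{1..m}).

(** Multiplication and differentiation of series involve finitely many coefficients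
    in each degree, so identities are transported from the polynomials that agree
    with the given series below a degree [d]. *)
Definition mfps_approx (d : nat) p f := forall a, (mdeg a < d)%N -> p@_a = f a.

Lemma mfps_approx_exists d f : exists p, mfps_approx d p f.
Proof.
exists (\sum_(k : 'X_{1..m < d}) f k *: 'X_[k]) => a ad.
by rewrite (mcoeff_mpoly f ad).
Qed.

Lemma mfps_approxM d p q f g :
  mfps_approx d p f -> mfps_approx d q g -> mfps_approx d (p * q) (f * g).
Proof.
move=> pf qg a ad; rewrite mcoeffM; apply: eq_bigr => -[[k1 /= k1a] [k2 /= k2a]] _ /=.
by rewrite pf ?qg // (leq_trans _ ad).
Qed.

Lemma mfps_approx1 d : mfps_approx d 1 1.
Proof. by move=> a _; rewrite mcoeff1. Qed.

Lemma mfps_approx_var d i : mfps_approx d 'X_i (mfps_var R i).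
Proof. by move=> a _; rewrite mcoeffX eq_sym. Qed.

Lemma mfps_approxXn d p f n : mfps_approx d p f -> mfps_approx d (p ^+ n) (f ^+ n).
Proof.
move=> pf; elim: n => [|n IHn]; first exact: mfps_approx1.
by rewrite !exprS; apply: mfps_approxM.
Qed.

Lemma mfps_approx_monomial d b : mfps_approx d 'X_[b] (mfps_monomial R b).
Proof.
rewrite mpolyXE_id /mfps_monomial.
apply: (big_ind2 (fun p f => mfps_approx d p f)).
- exact: mfps_approx1.
- by move=> p f q g; apply: mfps_approxM.
- by move=> i _; apply/mfps_approxXn/mfps_approx_var.
Qed.

Lemma mfps_monomialE a b : mfps_monomial R b a = (a == b)%:R.
Proof. by rewrite -(@mfps_approx_monomial _ b _ (ltnSn (mdeg a))) mcoeffX eq_sym. Qed.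

Lemma mfps_coefMmonomial f b a :
  (f * mfps_monomial R b) a = if (b <= a)%MM then f (a - b)%MM else 0.
Proof.
have [p pf] := mfps_approx_exists (mdeg a).+1 f.
rewrite -(mfps_approxM pf (@mfps_approx_monomial _ b) (ltnSn _)).
case: ifPn => [ba|Nba].
  by rewrite -{1}(submK ba) addmC mcoeffMX pf // ltnS mdegB.
rewrite mcoeffM big1 // => -[k1 k2] /= /eqP ak.
rewrite mcoeffX; case: eqP => [bk|]; last by rewrite mulr0.
by case/negP: Nba; rewrite ak bk; apply/mnm_lepP => i; rewrite mnmDE leq_addl.
Qed.

Lemma mfps_monomialU (i : 'I_m) : mfps_monomial R U_(i) = mfps_var R i.
Proof. by apply: mfpsP => a; rewrite mfps_monomialE. Qed.

Lemma mfps_monomialMn (i : 'I_m) n : mfps_monomial R (U_(i) *+ n) = mfps_var R i ^+ n.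
Proof.
apply: mfpsP => a; rewrite mfps_monomialE.
rewrite -(mfps_approxXn n (@mfps_approx_var _ i) (ltnSn (mdeg a))).
by rewrite mpolyXn mcoeffX eq_sym.
Qed.

Definition order_ge (n : nat) f := forall a, (mdeg a < n)%N -> f a = 0.

Lemma order_geD n f g : order_ge n f -> order_ge n g -> order_ge n (f + g).
Proof. by move=> fn gn a an; rewrite /= fn ?gn ?addr0. Qed.

Lemma order_geN n f : order_ge n f -> order_ge n (- f).
Proof. by move=> fn a an; rewrite /= fn ?oppr0. Qed.

Lemma order_ge_sum (I : Type) (r : seq I) (F : I -> P) n :
  (forall i, order_ge n (F i)) -> order_ge n (\sum_(i <- r) F i).
Proof.
move=> Fn; apply: (big_ind (order_ge n)) => //.
by move=> f g; apply: order_geD.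
Qed.

Lemma order_geM k l f g : order_ge k f -> order_ge l g -> order_ge (k + l) (f * g).
Proof.
move=> fk gl a akl; rewrite /= big1 // => -[k1 k2] /= /eqP ak.
have [/fk-> | k1k] := ltnP (mdeg k1) k; first by rewrite mul0r.
rewrite gl ?mulr0 // -(ltn_add2l k) (leq_ltn_trans _ akl) //.
by rewrite [in leqRHS]ak mdegD leq_add2r.
Qed.

Lemma order_ge_var (i : 'I_m) : order_ge 1 (mfps_var R i).
Proof.
move=> a; rewrite ltnS leqn0 mdeg_eq0 => /eqP-> /=.
by case: eqP => // /(congr1 (@mdeg m)) /eqP; rewrite mdeg0 mdeg1.
Qed.

Lemma order_ge1 f : f 0%MM = 0 -> order_ge 1 f.
Proof. by move=> f0 a; rewrite ltnS leqn0 mdeg_eq0 => /eqP->. Qed.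

Lemma order_ge_all f g : (forall n, order_ge n (f - g)) -> f = g.
Proof.
move=> fg; apply: mfpsP => a; apply/eqP; rewrite -subr_eq0; apply/eqP.
exact: (fg (mdeg a).+1 a (ltnSn _)).
Qed.

Lemma mfps_coef_sum (I : Type) (r : seq I) (F : I -> P) a :
  (\sum_(i <- r) F i) a = \sum_(i <- r) F i a.
Proof. by elim/big_rec2: _ => //= i x y _ <-. Qed.

Lemma mfps_coefZ (c : R) f a : (c *: f) a = c * f a.
Proof. by []. Qed.

(** Each term of [f] is divided by the first variable that occurs in its monomial. *)
Lemma order_ge_decomp n f : order_ge n.+1 f ->
  exists2 h : 'I_m -> P, (forall i, order_ge n (h i)) &
    f = \sum_(i < m) mfps_var R i * h i.
Proof.
move=> fn; pose lead a := [pick j | a j != 0%N].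
exists (fun i => Mfps (fun a =>
  if lead (a + U_(i))%MM == Some i then f (a + U_(i))%MM else 0)).
  by move=> i a an /=; case: ifP => // _; rewrite fn // mdegD mdeg1 addn1.
apply: mfpsP => a.
rewrite mfps_coef_sum.
rewrite (eq_bigr (fun i => if lead a == Some i then f a else 0)) => [|i _].
  rewrite /lead; case: pickP => [j aj|a0].
    rewrite (bigD1 j) //= eqxx big1 ?addr0 // => i /negPf ij.
    by case: eqP => // -[ji]; rewrite ji eqxx in ij.
  rewrite big1 // fn // ltnS (_ : a = 0%MM) ?mdeg0 //.
  by apply/mnmP => i; have /negbFE/eqP := a0 i; rewrite mnm0E.
rewrite mulrC -mfps_monomialU mfps_coefMmonomial /=.
have [Ua|NUa] := boolP (U_(i) <= a)%MM; first by rewrite submK.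
rewrite /lead; case: pickP => // j aj; case: eqP => // -[ji].
case/negP: NUa; apply/mnm_lepP => k; rewrite mnm1E.
by case: eqP => // <-; rewrite lt0n -ji.
Qed.

Lemma mfps_maxidealP f : order_ge 1 f <-> mfps_maxideal f.
Proof.
split=> [/order_ge_decomp[h _ ->]|[h ->]].
  by exists h; apply: eq_bigr => i _; rewrite mulrC.
by apply: order_ge_sum => i; apply: (@order_geM 0) (@order_ge_var i).
Qed.

Lemma ideal_exp_order n f : ideal_exp (@mfps_maxideal m R) n f <-> order_ge n f.
Proof.
elim: n f => [|n IHn] f; first by split.
split=> [[s sI ->]|/order_ge_decomp[h hn ->]].
  rewrite big_seq; apply: (big_ind (order_ge n.+1)) => //.
    by move=> ? ?; apply: order_geD.
  by move=> p /sI[/mfps_maxidealP p1 /IHn p2]; apply: (@order_geM 1).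
exists [seq (mfps_var R i, h i) | i <- index_enum 'I_m]; last by rewrite big_map.
move=> _ /mapP[i _ ->] /=; split; last exact/IHn.
exact/mfps_maxidealP/order_ge_var.
Qed.

Lemma adic_nbhsP f (A : set P) :
  nbhs f A <-> exists n, [set g : P | order_ge n (g - f)] `<=` A.
Proof.
split=> [[n _ nA]|[n nA]].
  by exists n => g /= /ideal_exp_order; apply: nA.
by exists n => // g /= /ideal_exp_order; apply: nA.
Qed.

Lemma mfps_hausdorff : hausdorff_space P.
Proof.
move=> f g fg; apply: order_ge_all => n.
have nbhs_n (h : P) : nbhs h [set k : P | order_ge n (k - h)] by apply/adic_nbhsP; exists n.
have [h [/= hf hg]] := fg _ _ (nbhs_n f) (nbhs_n g).
rewrite -(subrKA h) -(opprB h f); exact/order_geD/hg/order_geN.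
Qed.

Lemma mfps_algE (c : R) : c%:A = Mfps (fun a => if a == 0%MM then c else 0) :> P.
Proof. by apply: mfpsP => a /=; case: eqP => _; rewrite ?mulr1 ?mulr0. Qed.

Lemma mfps_coef0M f g : (f * g) 0%MM = f 0%MM * g 0%MM.
Proof.
have d0 : (mdeg (0 : 'X_{1..m}) < 1)%N by rewrite mdeg0.
have [p pf] := mfps_approx_exists 1 f; have [q qg] := mfps_approx_exists 1 g.
by rewrite -(mfps_approxM pf qg d0) rmorphM /= pf ?qg.
Qed.

Lemma mfps_coef0X f n : (f ^+ n) 0%MM = f 0%MM ^+ n.
Proof.
elim: n => [|n IHn]; first by rewrite /= eqxx.
by rewrite !exprS mfps_coef0M IHn.
Qed.

Lemma order_geX f n : order_ge 1 f -> order_ge n (f ^+ n).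
Proof.
move=> f1; elim: n => [//|n IHn]; rewrite exprS; exact: (@order_geM 1).
Qed.

End Order.

(** * Partial derivatives *)

Section Derivative.
Context (m : nat) (K : fieldType).
Local Notation P := (mfps m K).
Implicit Types (f g : P) (p q : {mpoly K[m]}) (a : 'X_{1..m}).

Lemma mfps_approx_deriv d p f i :
  mfps_approx d.+1 p f -> mfps_approx d p^`M(i) (mfps_deriv i f).
Proof. by move=> pf a ad; rewrite mcoeff_deriv pf //= mdegD mdeg1 addn1. Qed.

Lemma mfps_derivM i f g :
  mfps_deriv i (f * g) = mfps_deriv i f * g + f * mfps_deriv i g.
Proof.
apply: mfpsP => a; pose d := (mdeg a).+1; have ad : (mdeg a < d)%N by [].
have [p pf] := mfps_approx_exists d.+1 f.
have [q qg] := mfps_approx_exists d.+1 g.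
have shrink (r : {mpoly K[m]}) (h : P) :
    mfps_approx d.+1 r h -> mfps_approx d r h.
  by move=> rh b bd; apply/rh/ltnW.
rewrite -(mfps_approx_deriv i (mfps_approxM pf qg) ad) mderivM mcoeffD.
rewrite (mfps_approxM (mfps_approx_deriv i pf) (shrink _ _ qg) ad).
by rewrite (mfps_approxM (shrink _ _ pf) (mfps_approx_deriv i qg) ad).
Qed.

Lemma mfps_derivD i f g :
  mfps_deriv i (f + g) = mfps_deriv i f + mfps_deriv i g.
Proof. by apply: mfpsP => a; rewrite /= mulrnDl. Qed.

Lemma mfps_deriv_alg i (c : K) : mfps_deriv i (c%:A : P) = 0.
Proof.
apply: mfpsP => a; rewrite mfps_algE /=.
by rewrite -mdeg_eq0 mdegD mdeg1 addn1 mul0rn.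
Qed.

Lemma mfps_deriv_var i j : mfps_deriv i (mfps_var K j) = (i == j)%:R :> P.
Proof.
have -> : (i == j)%:R = ((i == j)%:R : K)%:A :> P by case: eqP; rewrite ?scale1r ?scale0r.
apply: mfpsP => a; rewrite mfps_algE /=.
have [->|a0] := eqVneq a 0%MM.
  rewrite add0m mnm0E mulr1n; congr (nat_of_bool _)%:R.
  apply/eqP/eqP => [|-> //]; move=> /mnmP/(_ j).
  by rewrite !mnm1E eqxx; case: (i =P j).
case: eqP => [/(congr1 (@mdeg m))|]; last by rewrite mul0rn.
rewrite mdegD !mdeg1 addn1 => -[/eqP]; by rewrite mdeg_eq0 (negPf a0).
Qed.

Lemma mfps_iter_deriv i k f a :
  iter k (mfps_deriv i) f a = f (a + U_(i) *+ k)%MM *+ (a i + k) ^_ k.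
Proof.
elim: k a => [|k IHk] a.
  by rewrite ffactn0 mulr1n; congr (f _); apply/mnmP => j; rewrite mnmDE mulmnE muln0 addn0.
rewrite /= IHk -mulrnA mnmDE mnm1E eqxx addn1 addSnnS ffactnSr -addSnnS addnK.
by rewrite -addmA -mulmS.
Qed.

(** The composition is computed along a duplicate-free list of variables, so that
    the derivatives already applied do not change the exponents of the others. *)
Lemma coef0_deriv_exp (alpha : 'X_{1..m}) g :
  (\big[comp/idfun]_(i < m) iter (alpha i) (mfps_deriv i)) g 0%MM
  = g alpha *+ (\prod_(i < m) (alpha i)`!).
Proof.
suff H (r : seq 'I_m) a : uniq r ->
    (\big[comp/idfun]_(i <- r) iter (alpha i) (mfps_deriv i)) g a
    = g (a + \sum_(i <- r) U_(i) *+ alpha i)%MM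
        *+ (\prod_(i <- r) (a i + alpha i) ^_ (alpha i)).
  rewrite H ?index_enum_uniq // add0m -multinomUE_id; congr (_ *+ _).
  by apply: eq_bigr => i _; rewrite mnm0E ffactnn.
elim: r a => [|i r IHr] a; first by rewrite !big_nil /= addm0.
rewrite /= => /andP[ir ur]; rewrite !big_cons /= mfps_iter_deriv IHr //.
rewrite -mulrnA addmA mulnC; congr (_ *+ (_ * _)%N).
rewrite big_seq [RHS]big_seq; apply: eq_bigr => j jr.
rewrite mnmDE mulmnE mnm1E; case: eqP => [ij|]; first by rewrite ij jr in ir.
by rewrite mul0n addn0.
Qed.

End Derivative.

(** * Setting variables to zero *)

Section Substitution.
Context (m : nat) (K : fieldType).
Local Notation P := (mfps m K).
Implicit Types (f g : P) (a : 'X_{1..m}).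

Definition mfps_at0 (i : 'I_m) f : P := Mfps (fun a => if a i == 0%N then f a else 0).

Lemma alternating_bin_sum (N n : nat) :
  \sum_(0 <= k < n.+1) (-1) ^+ k * 'C(N.+1, k)%:R = (-1) ^+ n * 'C(N, n)%:R :> K.
Proof.
elim: n => [|n IHn]; first by rewrite big_nat1 !bin0.
rewrite big_nat_recr //= IHn binS natrD exprS !mulN1r mulrDr !mulNr.
by rewrite addrC -addrA addNr addr0.
Qed.

(** The coefficient of [x^a] in [x_i ^ k * d_i ^ k g / k!] is ['C(a i, k)] times that of
    [g], so the partial sum multiplies it by an alternating sum of binomial coefficients,
    which vanishes unless [a i = 0] as soon as [a i < n]. *)
Lemma taylor_at0_order (charK : [pchar K] =i pred0) (i : 'I_m) g n :
  order_ge n (\sum_(0 <= k < n)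
    (-1) ^+ k * ((k`!%:R : K)^-1 *: mfps_var K i ^+ k)
      * iter k (mfps_deriv i) g - mfps_at0 i g).
Proof.
move=> a an; rewrite /=.
rewrite mfps_coef_sum.
rewrite (eq_bigr (fun k => (-1) ^+ k * 'C(a i, k)%:R * g a)) => [|k _].
  rewrite -mulr_suml.
  have ain : (a i < n)%N.
    by rewrite (leq_ltn_trans _ an) // mdegE (bigD1 i) //= leq_addr.
  case: n an ain => // n an ain; case E: (a i) => [|N].
    rewrite big_nat_recl //= big1 => [|k _]; last by rewrite bin_small ?mulr0.
    by rewrite bin0 expr0 mul1r addr0 mul1r subrr.
  rewrite alternating_bin_sum bin_small ?mulr0 ?mul0r ?subrr //.
  by rewrite E in ain.
have -> : (-1) ^+ k = ((-1) ^+ k : K)%:A :> P.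
  by rewrite -[RHS]/(in_alg P _) rmorph_sign.
rewrite mulr_algl scalerA -scalerAl [mfps_var K i ^+ k * _]mulrC -mfps_monomialMn.
rewrite mfps_coefZ mfps_coefMmonomial -!mulrA; congr (_ * _).
have k0 : k`!%:R != 0 :> K by rewrite (iffLR (pcharf0P _) charK) -lt0n fact_gt0.
case: ifPn => [Ua|NUa]; last first.
  rewrite mulr0 bin_small ?mul0r //; rewrite ltnNge.
  apply: contraNN NUa => kai; apply/mnm_lepP => j; rewrite mulmnE mnm1E.
  by case: eqP => [<-|]; rewrite ?mul1n ?mul0n.
have kai : (k <= a i)%N.
  by have /mnm_lepP/(_ i) := Ua; rewrite mulmnE mnm1E eqxx mul1n.
rewrite mfps_iter_deriv submK // mnmBE mulmnE mnm1E eqxx mul1n subnK //.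
by rewrite -bin_ffact -[g a *+ _]mulr_natr natrM [RHS]mulrC [_%:R * _%:R]mulrC
  [g a * _]mulrCA mulKf.
Qed.

Lemma big_at0 g :
  (\big[comp/idfun]_(i < m) @mfps_at0 i) g = (g 0%MM)%:A.
Proof.
have H (r : seq 'I_m) a : (\big[comp/idfun]_(i <- r) @mfps_at0 i) g a
    = if all (fun i => a i == 0%N) r then g a else 0.
  elim: r => [|i r IHr]; first by rewrite big_nil.
  by rewrite big_cons /= IHr; case: eqP.
apply: mfpsP => a; rewrite H mfps_algE /=; case: eqP => [->|a0].
  by rewrite (_ : all _ _) //; apply/allP => i _; rewrite mnm0E.
case: ifP => // /allP az; case: a0; apply/mnmP => i.
by rewrite mnm0E; apply/eqP/az/mem_index_enum.
Qed.

Lemma monomial_expansion f :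
  (fun F : {fset 'X_{1..m}} => \sum_(alpha <- F) f alpha *: mfps_monomial K alpha)
    @ totally --> f.
Proof.
move=> A /adic_nbhsP[n nA].
exists [fset bmnm b | b in {: 'X_{1..m < n}}]%fset => // F /= nF.
apply: nA => a an /=.
have aF : a \in F.
  apply: (fsubsetP nF); apply/imfsetP; by exists (BMultinom an).
rewrite mfps_coef_sum (big_fsetD1 a) //= mfps_monomialE eqxx mulr1.
rewrite big_seq big1 ?addr0 ?subrr // => b.
by rewrite !inE mfps_monomialE eq_sym => /andP[/negPf-> _]; rewrite mulr0.
Qed.

End Substitution.

(** * Conjugation by the automorphism *)

Section Cramer.
Context (A : comNzRingType) (n : nat).

(** Cramer's rule: expanding along row [i] leaves the cofactors of [M], and
    [v *m M *m \adj M] is the multiple of [v] by [\det M]. *)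
Lemma det_replace_row (M : 'M[A]_n) (v : 'rV[A]_n) i :
  \det (\matrix_(k, l) if k == i then (v *m M) 0 l else M k l) = v 0 i * \det M.
Proof.
transitivity ((v *m M *m \adj M) 0 i); last first.
  by rewrite -mulmxA mul_mx_adj mul_mx_scalar mxE mulrC.
rewrite (expand_det_row _ i) [RHS]mxE; apply: eq_bigr => l _.
rewrite mxE eqxx [\adj M l i]mxE /cofactor; congr (_ * (_ * \det _)).
by apply/matrixP => r c; rewrite !mxE eq_sym (negPf (neq_lift _ _)).
Qed.

End Cramer.

Section Automorphism.
Context (m : nat) (K : fieldType).
Local Notation P := (mfps m K).
Implicit Types g : P.
Context (sigma : {lrmorphism P -> P}) (sigma_inv : P -> P).
Context (sigma_invK : cancel sigma_inv sigma) (sigma_cont : continuous sigma).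

(** The powers of a variable tend to [0], hence so do those of its image, whose
    constant term is then nilpotent. *)
Lemma order_ge_sigma_var (i : 'I_m) : order_ge 1 (sigma (mfps_var K i)).
Proof.
have : nbhs (sigma 0) [set f : P | f 0%MM = 0].
  apply/adic_nbhsP; exists 1%N => f /=; rewrite rmorph0 subr0; apply.
  by rewrite mdeg0.
move=> /(@sigma_cont 0)/adic_nbhsP[N NA].
have /NA/= : order_ge N (mfps_var K i ^+ N - 0).
  by rewrite subr0; apply/order_geX/order_ge_var.
rewrite rmorphXn mfps_coef0X => /eqP; rewrite expf_eq0 => /andP[_ /eqP].
exact: order_ge1.
Qed.

(** Both sides are derivations along [sigma] that agree on constants and variables.
    If [E] is their difference and [g] is a constant plus [\sum_i x_i * h_i], then
    [E g = \sum_i sigma x_i * E h_i], so a lower bound on the order of all values of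
    [E] can be increased by one. *)
Lemma chain_rule l g : mfps_deriv l (sigma g) =
  \sum_k sigma (mfps_deriv k g) * jacobian_mx sigma k l.
Proof.
pose E f := mfps_deriv l (sigma f)
  - \sum_k sigma (mfps_deriv k f) * jacobian_mx sigma k l.
have ED f h : E (f + h) = E f + E h.
  rewrite /E rmorphD mfps_derivD addrACA -opprD -big_split /=; congr (_ - _).
  by apply: eq_bigr => k _; rewrite mfps_derivD rmorphD mulrDl.
have EC (c : K) : E c%:A = 0.
  rewrite /E linearZ rmorph1 mfps_deriv_alg big1 ?subrr // => k _.
  by rewrite mfps_deriv_alg rmorph0 mul0r.
have E0 : E 0 = 0 by rewrite -[in LHS](scale0r 1) EC.
have EX i h : E (mfps_var K i * h) = sigma (mfps_var K i) * E h.
  rewrite /E rmorphM mfps_derivM mulrBr mulr_sumr.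
  rewrite (eq_bigr (fun k => (k == i)%:R * sigma h * jacobian_mx sigma k l +
     sigma (mfps_var K i) * (sigma (mfps_deriv k h) * jacobian_mx sigma k l))).
    rewrite big_split /= (bigD1 i) //= eqxx mul1r big1 ?addr0.
      by rewrite mxE mulrC opprD addrACA subrr add0r.
    by move=> k /negPf->; rewrite !mul0r.
  move=> k _; rewrite mfps_derivM mfps_deriv_var rmorphD !rmorphM rmorph_nat.
  by rewrite mulrDl mulrA.
apply: order_ge_all => n; rewrite -/(E g).
elim: n g => [//|n IHn] g.
have /order_ge_decomp[h _ gE] : order_ge 1 (g - (g 0%MM)%:A).
  by apply: order_ge1; rewrite mfps_algE /= eqxx subrr.
rewrite -(subrK (g 0%MM)%:A g) gE ED EC addr0.
rewrite (big_morph E ED E0).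
apply: order_ge_sum => i; rewrite EX.
exact: (order_geM (order_ge_sigma_var i) (IHn _)).
Qed.

(** The chain rule for [x_k = sigma (sigma_inv x_k)] exhibits a left inverse of the
    Jacobian matrix. *)
Lemma jacobian_unit : \det (jacobian_mx sigma) \is a GRing.unit.
Proof.
pose A : 'M[P]_m :=
  \matrix_(k, j) sigma (mfps_deriv j (sigma_inv (mfps_var K k))).
suff /mulmx1_unit[_] : A *m jacobian_mx sigma = 1%:M by rewrite unitmxE.
apply/matrixP => k l; rewrite !mxE.
under eq_bigr do rewrite [A _ _]mxE.
by rewrite -chain_rule sigma_invK mfps_deriv_var eq_sym.
Qed.

(** The gradient of [sigma g] is, by the chain rule, the combination of the rows
    of the Jacobian matrix with coefficients [sigma (mfps_deriv k g)]; Cramer's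
    rule reads off the coefficient of row [i]. *)
Lemma deriv'_sigma i g : deriv' sigma i (sigma g) = sigma (mfps_deriv i g).
Proof.
pose v : 'rV_m := \row_k sigma (mfps_deriv k g).
rewrite /deriv' (_ : (\matrix_(k, l) _) = \matrix_(k, l)
    if k == i then (v *m jacobian_mx sigma) 0 l else jacobian_mx sigma k l).
  by rewrite det_replace_row mulrC mulrK ?jacobian_unit // mxE.
apply/matrixP => k l; rewrite !mxE; case: eqP => // _.
by rewrite chain_rule; apply: eq_bigr => j _; rewrite [v _ _]mxE.
Qed.

Lemma iter_deriv'_sigma i k g :
  iter k (deriv' sigma i) (sigma g) = sigma (iter k (mfps_deriv i) g).
Proof. by elim: k => //= k ->; rewrite deriv'_sigma. Qed.

Lemma phi'_sigma (charK : [pchar K] =i pred0) i g :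
  phi' sigma i (sigma g) = sigma (mfps_at0 i g).
Proof.
apply: (cvg_lim (@mfps_hausdorff m K)).
pose T n := \sum_(0 <= k < n)
    (-1) ^+ k * ((k`!%:R : K)^-1 *: mfps_var K i ^+ k)
      * iter k (mfps_deriv i) g.
rewrite (_ : (fun n => _) = sigma \o T); last first.
  apply/funext => n /=; rewrite rmorph_sum; apply: eq_bigr => k _.
  by rewrite iter_deriv'_sigma !rmorphM rmorph_sign /= linearZ /= rmorphXn.
apply: (@cvg_comp _ _ _ T sigma _ (nbhs (mfps_at0 i g))); last exact: sigma_cont.
move=> A /adic_nbhsP[n nA]; exists n => // k /= nk; apply: nA => a an.
exact/(taylor_at0_order charK)/(leq_trans an).
Qed.

Lemma big_comp_sigma (A B : 'I_m -> P -> P) g :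
  (forall i g, A i (sigma g) = sigma (B i g)) ->
  (\big[comp/idfun]_(i < m) A i) (sigma g) = sigma ((\big[comp/idfun]_(i < m) B i) g).
Proof.
move=> AB; elim: (index_enum 'I_m) => [|i r IHr]; first by rewrite !big_nil.
by rewrite !big_cons /= IHr AB.
Qed.

End Automorphism.

Theorem theorem4p3 (K : fieldType) (charK : [pchar K] =i pred0)
    (m : nat) (m_gt0 : (0 < m)%N)
    (sigma : {lrmorphism mfps m K -> mfps m K})
    (sigma_inv : mfps m K -> mfps m K)
    (sigmaK : cancel sigma sigma_inv) (sigma_invK : cancel sigma_inv sigma)
    (sigma_cont : continuous sigma) (a : mfps m K) :
  (fun F : {fset 'X_{1..m}} =>
     \sum_(alpha <- F)
        phi sigma (((\prod_(i < m) (alpha i)`!)%:R : K)^-1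
                     *: deriv'_exp sigma alpha a)
        * mfps_monomial K alpha) @ totally --> sigma_inv a.
Proof.
set b := sigma_inv a; rewrite -[a]sigma_invK -/b.
rewrite (_ : (fun F => _) =
    fun F : {fset 'X_{1..m}} => \sum_(alpha <- F) b alpha *: mfps_monomial K alpha).
  exact: monomial_expansion.
apply/funext => F; apply: eq_bigr => alpha _.
rewrite -[RHS]mulr_algl; congr (_ * _).
rewrite /deriv'_exp (big_comp_sigma (B := fun i => iter (alpha i) (mfps_deriv i))).
  rewrite -linearZ /phi (big_comp_sigma (B := @mfps_at0 m K)).
    rewrite big_at0 linearZ rmorph1 /= coef0_deriv_exp -[b alpha *+ _]mulr_natl.
    rewrite mulKf // (iffLR (pcharf0P _) charK) -lt0n; apply: prodn_gt0 => i.
    exact: fact_gt0.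
  by move=> i g; apply: (phi'_sigma sigma_invK).
by move=> i g; apply: (iter_deriv'_sigma sigma_invK).
Qed.
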